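(* For any $\Sigma\cup\{\alpha,\beta\}\subseteq\mathit{Fm}$: (i) if $\Sigma\cup\{\alpha\}\vdash_{\mathrm{HIPWK}}\beta$ then $\Sigma\vdash_{\mathrm{HIPWK}}\alpha\longrightarrow\beta$; (ii) if $\Sigma\vdash_{\mathrm{HIPWK}}\alpha\longrightarrow\beta$ and $\mathrm{var}(\alpha)\subseteq\mathrm{var}(\beta)$, then $\Sigma\cup\{\alpha\}\vdash_{\mathrm{HIPWK}}\beta$.
   Context: Formulas $\mathit{Fm}$ are built over a countably infinite set $V$ of variables in the language $\{\land,\lor,\longrightarrow,\neg,0,1\}$. $\mathrm{var}(\varphi)$ is the set of variables in $\varphi$. HIPWK is the Hilbert-style logic (derivations from hypotheses $\Sigma$ as finite sequences of axiom instances, hypotheses, and rule applications) with axiom schemes (A1) $\alpha\longrightarrow(\beta\longrightarrow\alpha)$; (A2) $(\alpha\longrightarrow(\beta\longrightarrow\gamma))\longrightarrow((\alpha\longrightarrow\beta)\longrightarrow(\alpha\longrightarrow\gamma))$; (A3) $\alpha\longrightarrow(\beta\longrightarrow(\alpha\land\beta))$; (A4) $\alpha\land\beta\longrightarrow\alpha$; (A5) $\alpha\land\beta\longrightarrow\beta$; (A6) $\alpha\longrightarrow\alpha\lor\beta$; (A7) $\beta\longrightarrow\alpha\lor\beta$; (A8) $(\alpha\longrightarrow\gamma)\longrightarrow((\beta\longrightarrow\gamma)\longrightarrow(\alpha\lor\beta\longrightarrow\gamma))$; (A9) $(\alpha\longrightarrow\beta)\longrightarrow((\alpha\longrightarrow\neg\beta)\longrightarrow\neg\alpha)$;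 (A10) $0\longrightarrow\alpha$, and the single rule $\frac{\alpha,\ \alpha\longrightarrow\beta}{\beta}$ provided $\mathrm{var}(\alpha)\subseteq\mathrm{var}(\beta)$. *)

(* Defs.v *)
From mathcomp Require Import all_boot.
From mathcomp Require Import boolp classical_sets functions cardinality.

Set Implicit Arguments.
Unset Strict Implicit.
Unset Printing Implicit Defensive.

Local Open Scope classical_set_scope.

Inductive fm (V : Type) : Type :=
| Var of V
| Zero
| One
| Neg of fm V
| And of fm V & fm V
| Or of fm V & fm V
| Imp of fm V & fm V.

Arguments Zero {V}.
Arguments One {V}.

Declare Scope fm_scope.
Delimit Scope fm_scope with F.
Bind Scope fm_scope with fm.
Notation "a ∧ b" := (And a b) (at level 40, left associativity) : fm_scope.
Notation "a ∨ b" := (Or a b) (at level 50, left associativity) : fm_scope.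
Notation "a ⟶ b" := (Imp a b) (at level 60, right associativity) : fm_scope.
Notation "¬ a" := (Neg a) (at level 35, right associativity) : fm_scope.

Fixpoint var {V : Type} (phi : fm V) : set V :=
  match phi with
  | Var x => [set x]
  | Zero | One => set0
  | Neg a => var a
  | And a b | Or a b | Imp a b => var a `|` var b
  end.

Inductive hipwk_axiom {V : Type} : fm V -> Prop :=
| A1 a b : hipwk_axiom (a ⟶ (b ⟶ a))
| A2 a b c : hipwk_axiom ((a ⟶ (b ⟶ c)) ⟶ ((a ⟶ b) ⟶ (a ⟶ c)))
| A3 a b : hipwk_axiom (a ⟶ (b ⟶ (a ∧ b)))
| A4 a b : hipwk_axiom ((a ∧ b) ⟶ a)
| A5 a b : hipwk_axiom ((a ∧ b) ⟶ b)
| A6 a b : hipwk_axiom (a ⟶ (a ∨ b))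
| A7 a b : hipwk_axiom (b ⟶ (a ∨ b))
| A8 a b c : hipwk_axiom ((a ⟶ c) ⟶ ((b ⟶ c) ⟶ ((a ∨ b) ⟶ c)))
| A9 a b : hipwk_axiom ((a ⟶ b) ⟶ ((a ⟶ ¬ b) ⟶ ¬ a))
| A10 a : hipwk_axiom (Zero ⟶ a).

Definition restricted_mp {V : Type} (premise major conclusion : fm V) : Prop :=
  major = (premise ⟶ conclusion)%F /\ var premise `<=` var conclusion.

(* All indices used below are within bounds, so the default value [Zero] of
   [nth] is never read. *)
Definition derivation {V : Type} (Sigma : set (fm V)) (s : seq (fm V)) : Prop :=
  forall i, (i < size s)%N ->
    [\/ hipwk_axiom (nth Zero s i),
        Sigma (nth Zero s i)
      | exists j k, [/\ (j < i)%N, (k < i)%N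
          & restricted_mp (nth Zero s j) (nth Zero s k) (nth Zero s i)]].

Definition hipwk {V : Type} (Sigma : set (fm V)) (phi : fm V) : Prop :=
  exists s : seq (fm V), derivation Sigma (rcons s phi).

Notation "Sigma ⊢ phi" := (hipwk Sigma phi%F)
  (at level 90, no associativity) : type_scope.

(* Main.v *)
Require Import Defs.
From mathcomp Require Import all_boot.
From mathcomp Require Import boolp classical_sets functions cardinality.

Local Open Scope classical_set_scope.

(** The textbook deduction theorem goes through because every application of
    modus ponens it introduces respects the variable restriction: var a is
    contained in var (b ⟶ a), the premise and the conclusion of (A2) have the
    same variables, and var a `<=` var b gives
    var (c ⟶ a) `<=` var (c ⟶ b). *)

Section Derivations.
Context {V : Type}.
Implicit Types (Sigma : set (fm V)) (phi a b : fm V) (s t : seq (fm V)).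

(** Rule applications refer only to earlier entries, so those in [s] stay valid as they are and
    those in [t] stay valid once their indices are shifted by [size s]. *)
Lemma derivation_cat Sigma s t :
  derivation Sigma s -> derivation Sigma t -> derivation Sigma (s ++ t).
Proof.
move=> ds dt i; rewrite size_cat nth_cat => it.
case: ltnP => [lt_is|le_si].
  case: (ds i lt_is) => [|| [j [k [ji ki mp]]]];
    [exact: Or31 | exact: Or32 | apply: Or33].
  by exists j, k; split; rewrite // !nth_cat (ltn_trans ji) // (ltn_trans ki).
have : i - size s < size t by rewrite ltn_subLR.
case/dt=> [|| [j [k [ji ki mp]]]]; [exact: Or31 | exact: Or32 | apply: Or33].
exists (size s + j), (size s + k); rewrite -!ltn_subRL; split=> //.
by rewrite !nth_cat !ltnNge !leq_addr /= !addKn.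
Qed.

Lemma derivation_rcons_mp Sigma s a b :
  derivation Sigma s -> (exists2 j, j < size s & nth Zero s j = a) ->
  (exists2 k, k < size s & nth Zero s k = (a ⟶ b)%F) ->
  var a `<=` var b -> derivation Sigma (rcons s b).
Proof.
move=> ds [j js ja] [k ks kab] ab i; rewrite size_rcons ltnS leq_eqVlt.
case/predU1P => [->|lt_is].
  apply: Or33; exists j, k; split=> //.
  by rewrite !nth_rcons js ks ltnn eqxx ja kab.
rewrite nth_rcons lt_is.
case: (ds i lt_is) => [|| [j' [k' [ji ki mp]]]];
  [exact: Or31 | exact: Or32 | apply: Or33].
by exists j', k'; split; rewrite // !nth_rcons (ltn_trans ji) // (ltn_trans ki).
Qed.

Lemma hipwk_ax Sigma phi : hipwk_axiom phi -> hipwk Sigma phi.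
Proof. by move=> ax; exists [::] => -[] // _; apply: Or31. Qed.

Lemma hipwk_hyp Sigma phi : Sigma phi -> hipwk Sigma phi.
Proof. by move=> Sphi; exists [::] => -[] // _; apply: Or32. Qed.

Lemma hipwk_mp Sigma a b :
  hipwk Sigma a -> hipwk Sigma (a ⟶ b)%F -> var a `<=` var b -> hipwk Sigma b.
Proof.
move=> [s ds] [t dt] ab; exists (rcons s a ++ rcons t (a ⟶ b)%F).
apply: derivation_rcons_mp ab; first exact: derivation_cat.
- exists (size s); first by rewrite size_cat !size_rcons ltn_addr.
  by rewrite nth_cat size_rcons ltnSn /= nth_rcons ltnn eqxx.
(* The successor counts [a], which closes the first block; [size t] is the position of the
   implication inside the second. *)
- exists ((size s).+1 + size t).
    by rewrite size_cat !size_rcons ltn_add2l.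
  by rewrite nth_cat size_rcons ltnNge leq_addr addKn /= nth_rcons ltnn eqxx.
Qed.

(** Rule induction, which frees the later proofs from indices. Strong induction on the position
    shows [P] at every entry of the derivation, since the premises of a rule may stand anywhere
    before its conclusion. *)
Lemma hipwk_elim Sigma (P : fm V -> Prop) :
  (forall phi, hipwk_axiom phi -> P phi) ->
  (forall phi, Sigma phi -> P phi) ->
  (forall a b, P a -> P (a ⟶ b)%F -> var a `<=` var b -> P b) ->
  forall phi, hipwk Sigma phi -> P phi.
Proof.
move=> Pax Phyp Pmp phi [s ds].
suff Ps i : i < size (rcons s phi) -> P (nth Zero (rcons s phi) i).
  by have := Ps (size s); rewrite size_rcons nth_rcons ltnn eqxx; apply.
elim/ltn_ind: i => i IH lt_i.
case: (ds i lt_i) => [/Pax//|/Phyp//|[j [k [ji ki [kE ab]]]]].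
apply: Pmp ab; first exact/IH/(ltn_trans ji).
by rewrite -kE; exact/IH/(ltn_trans ki).
Qed.

Lemma hipwk_sub Sigma (Delta : set (fm V)) phi :
  Sigma `<=` Delta -> hipwk Sigma phi -> hipwk Delta phi.
Proof.
move=> SD; apply: hipwk_elim; first exact: hipwk_ax.
- by move=> a /SD; exact: hipwk_hyp.
- exact: hipwk_mp.
Qed.

Lemma hipwk_imp_intro Sigma a phi : hipwk Sigma phi -> hipwk Sigma (a ⟶ phi)%F.
Proof.
move=> Sphi; apply: (hipwk_mp _ _ _ Sphi); last exact: subsetUr.
exact/hipwk_ax/A1.
Qed.

Lemma hipwk_imp_mp Sigma c a b :
  hipwk Sigma (c ⟶ a)%F -> hipwk Sigma (c ⟶ (a ⟶ b))%F ->
  var a `<=` var b -> hipwk Sigma (c ⟶ b)%F.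
Proof.
move=> Sca Scab ab; apply: (hipwk_mp _ _ _ Sca); last exact: setUS.
apply: (hipwk_mp _ _ _ Scab); first exact/hipwk_ax/A2.
by move=> x /=; tauto.
Qed.

Lemma hipwk_imp_refl Sigma a : hipwk Sigma (a ⟶ a)%F.
Proof.
(* The usual detour through [a ⟶ a]: both [a ⟶ (a ⟶ a)] and [a ⟶ ((a ⟶ a) ⟶ a)] are instances of
   (A1), and the formula detached has only the variables of [a]. *)
apply: (hipwk_imp_mp _ _ (a ⟶ a)%F); try exact/hipwk_ax/A1.
by move=> x /= [].
Qed.

(** Rule induction with [a] prefixed to every entry; in the modus ponens case the side condition of
    the original step is just what [hipwk_imp_mp] asks for. *)
Lemma hipwk_deduction Sigma a phi :
  hipwk (Sigma `|` [set a]) phi -> hipwk Sigma (a ⟶ phi)%F.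
Proof.
apply: (hipwk_elim _ (fun psi => hipwk Sigma (a ⟶ psi)%F))
  => [b ax|b [Sb|->]|b c].
- exact/hipwk_imp_intro/hipwk_ax.
- exact/hipwk_imp_intro/hipwk_hyp.
- exact: hipwk_imp_refl.
- exact: hipwk_imp_mp.
Qed.

End Derivations.

Theorem theorem4p14 (V : Type) (V_countably_infinite : ([set: V] #= [set: nat])%card)
    (Sigma : set (fm V)) (alpha beta : fm V) :
  ((Sigma `|` [set alpha] ⊢ beta) -> (Sigma ⊢ alpha ⟶ beta)) /\
  ((Sigma ⊢ alpha ⟶ beta) -> var alpha `<=` var beta ->
     (Sigma `|` [set alpha] ⊢ beta)).
Proof.
split=> [|Sab ab]; first exact: hipwk_deduction.
(* Detaching the new hypothesis [alpha] takes one rule application, whose side condition is [ab]. *)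
apply: hipwk_mp ab; first by apply: hipwk_hyp; right.
exact: hipwk_sub Sab.
Qed.
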